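(* Let $K\ge3$, $S_p=[1:K-2]$. The capacity region of the $K$-receiver combination network with two messages $M_{\overline{K}}$ (required by receivers $[1:K-1]$) and $M_{\overline{K-1}}$ (required by receivers $[1:K]\setminus\{K-1\}$) is the set of rate pairs $(R_{\overline{K}},R_{\overline{K-1}})$ with $R_{\overline{K-1}}\le C_{\mathsf{W}_K^{\mathsf{P}}}$, $R_{\overline{K}}\le C_{\mathsf{W}_{K-1}^{\mathsf{P}}}$, $R_{\overline{K-1}}+R_{\overline{K}}\le C_{\mathsf{W}_j^{\mathsf{P}}}$ for all $j\in S_p$, $R_{\overline{K-1}}+R_{\overline{K}}\le C_{\downarrow_{\mathsf{W}_{K-1}^{\mathsf{P}}}\{\overline{\{K\}}\}}+C_{\mathsf{W}_K^{\mathsf{P}}}$, $2R_{\overline{K-1}}+2R_{\overline{K}}\le C_{\downarrow_{\mathsf{W}_j^{\mathsf{P}}}\{\overline{\{K-1\}},\overline{\{K\}}\}}+C_{\mathsf{W}_K^{\mathsf{P}}}+C_{\mathsf{W}_{K-1}^{\mathsf{P}}}$ for all $j\in S_p$.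
   Context: The $K$-receiver combination network with capacities $C_S\ge0$, $S\in\mathsf{P}$ ($\mathsf{P}$ = nonempty subsets of $[1:K]$): the deterministic broadcast channel with input $X=(V_S:S\in\mathsf{P})$, $V_S$ in a finite set $\mathcal{V}_S$ with $|\mathcal{V}_S|=2^{C_S}$, and outputs $Y_i=(V_S:S\in\mathsf{W}_i^{\mathsf{P}})$, where $\mathsf{W}_i^{\mathsf{P}}=\{T\in\mathsf{P}:i\in T\}$. Messages are independent, each required by the indicated receivers; achievability (vanishing probability that some receiver mis-decodes a required message) and capacity region as usual. $C_{\mathsf{W}}=\sum_{S\in\mathsf{W}}C_S$; $\overline{A}=[1:K]\setminus A$; $\downarrow_{\mathsf{Q}_2}\mathsf{Q}_1=\{T\in\mathsf{Q}_2:T\subseteq T'\text{ for some }T'\in\mathsf{Q}_1\}$. *)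

(* Defs.v *)
From Stdlib Require Import Reals.
From HB Require Import structures.
From mathcomp Require Import all_boot.
Local Open Scope R_scope.
Set Implicit Arguments.
Unset Strict Implicit.
Unset Printing Implicit Defensive.

(* Receivers are indexed by 'I_K (receiver r of the paper is index r-1).
   The alphabet of V_S has size N S; C_S = log2 (N S). *)

Lemma in_set_neq0 (K : nat) (i : 'I_K) (S : {set 'I_K}) : i \in S -> S != set0.
Proof. by move=> h; apply/set0Pn; exists i. Qed.

Definition cap (K : nat) (N : {set 'I_K} -> nat) (S : {set 'I_K}) : R :=
  Rdiv (ln (INR (N S))) (ln 2).

Definition capW (K : nat) (N : {set 'I_K} -> nat) (W : {set {set 'I_K}}) : R :=
  foldr Rplus 0 (map (cap N) (enum W)).

Definition Wset (K : nat) (i : 'I_K) : {set {set 'I_K}} :=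
  [set S : {set 'I_K} | (S != set0) && (i \in S)].

Definition down (K : nat) (Q2 Q1 : {set {set 'I_K}}) : {set {set 'I_K}} :=
  [set T in Q2 | [exists T' in Q1, T \subset T']].

Definition cmpl (K : nat) (A : {set 'I_K}) : {set 'I_K} := ~: A.

Definition Xin (K : nat) (N : {set 'I_K} -> nat) :=
  forall S : {set 'I_K}, S != set0 -> 'I_(N S).

Definition Yout (K : nat) (N : {set 'I_K} -> nat) (i : 'I_K) :=
  forall S : {set 'I_K}, i \in S -> 'I_(N S).

Definition chan (K : nat) (N : {set 'I_K} -> nat) (i : 'I_K) (x : Xin N) : Yout N i :=
  fun S h => x S (in_set_neq0 h).

(* Two independent messages A (size MA) and B (size MB); A is required by the
   receivers in DA, B by the receivers in DB.  A code of block length n: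
   encoder enc, and for each receiver i decoders decA i, decB i acting on the
   received output sequence Y_i^n. *)
Definition err_event (K : nat) (N : {set 'I_K} -> nat) (DA DB : {set 'I_K})
  (n MA MB : nat) (enc : 'I_MA -> 'I_MB -> 'I_n -> Xin N)
  (decA : forall i : 'I_K, ('I_n -> Yout N i) -> 'I_MA)
  (decB : forall i : 'I_K, ('I_n -> Yout N i) -> 'I_MB)
  (m : 'I_MA * 'I_MB) : bool :=
  [exists i : 'I_K,
     ((i \in DA) && (decA i (fun t => @chan K N i (enc m.1 m.2 t)) != m.1))
  || ((i \in DB) && (decB i (fun t => @chan K N i (enc m.1 m.2 t)) != m.2))].

(* probability (messages uniform, independent) that some receiver
   mis-decodes a required message *)
Definition Perr (K : nat) (N : {set 'I_K} -> nat) (DA DB : {set 'I_K})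
  (n MA MB : nat) (enc : 'I_MA -> 'I_MB -> 'I_n -> Xin N)
  (decA : forall i : 'I_K, ('I_n -> Yout N i) -> 'I_MA)
  (decB : forall i : 'I_K, ('I_n -> Yout N i) -> 'I_MB) : R :=
  Rdiv (INR #|[set m | err_event DA DB enc decA decB m]|) (INR (MA * MB)%N).

(* (RA, RB) achievable: nonnegative, and there is a sequence of
   (ceil 2^{n RA}, ceil 2^{n RB}, n) codes whose error probability -> 0. *)
Definition achievable (K : nat) (N : {set 'I_K} -> nat) (DA DB : {set 'I_K})
  (RA RB : R) : Prop :=
  (0 <= RA) /\ (0 <= RB) /\
  forall eps : R, (0 < eps) -> exists n0 : nat, forall n : nat, (n0 <= n)%N ->
    exists (MA MB : nat),
      (Rpower 2 (INR n * RA) <= INR MA < Rpower 2 (INR n * RA) + 1) /\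
      (Rpower 2 (INR n * RB) <= INR MB < Rpower 2 (INR n * RB) + 1) /\
      exists (enc : 'I_MA -> 'I_MB -> 'I_n -> Xin N)
             (decA : forall i : 'I_K, ('I_n -> Yout N i) -> 'I_MA)
             (decB : forall i : 'I_K, ('I_n -> Yout N i) -> 'I_MB),
        (Perr DA DB enc decA decB <= eps).

Definition in_capacity_region (K : nat) (N : {set 'I_K} -> nat) (DA DB : {set 'I_K})
  (RA RB : R) : Prop :=
  forall eps : R, (0 < eps) -> exists a b : R,
    achievable N DA DB a b /\ (Rabs (a - RA) < eps) /\ (Rabs (b - RB) < eps).

(* Main.v *)
Require Import Defs.
From Stdlib Require Import Reals ZArith Lra FunctionalExtensionality ClassicalEpsilon.
From HB Require Import structures.
From mathcomp Require Import all_boot zify.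
Local Open Scope R_scope.
Set Implicit Arguments.
Unset Strict Implicit.
Unset Printing Implicit Defensive.

(** The last constraint is redundant: it is the sum of the bound at receiver
    [j] and of the bound obtained when receivers [K-1] and [K] cooperate. The
    other constraints are necessary by counting: on the set of correctly decoded
    message pairs, the outputs determine the messages they must reveal.

    For sufficiency split both messages into a common and a private part. A link
    [S] carries the common parts, the private part of [M_{bar K}] when [K] is not
    in [S], and the private part of [M_{bar (K-1)}] when [K-1] is not in [S]; thus
    every receiver decodes all that it sees. Taking the common parts as large as
    receivers [K-1] and [K] can decode, random coding succeeds at every rate
    pair in the region, scaled by a factor less than one. *)

(** * Naturals and powers of two as reals *)

Lemma INR_muln (a b : nat) : INR (a * b)%N = INR a * INR b.
Proof. exact: mult_INR. Qed.

Lemma INR_expn (a n : nat) : INR (a ^ n)%N = INR a ^ n.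
Proof. by elim: n => [|n IH] //; rewrite expnS INR_muln IH. Qed.

Lemma INR_leq (a b : nat) : (a <= b)%N -> INR a <= INR b.
Proof. by move/leP; apply: le_INR. Qed.

Lemma leq_INR (a b : nat) : INR a <= INR b -> (a <= b)%N.
Proof. by move=> h; apply/leP/INR_le. Qed.

Lemma ltn_INR (a b : nat) : INR a < INR b -> (a < b)%N.
Proof. by move=> h; apply/ltP/INR_lt. Qed.

Lemma ln2_gt0 : 0 < ln 2.
Proof. by rewrite -ln_1; apply: ln_increasing; lra. Qed.

Lemma Rpower2_gt0 (x : R) : 0 < Rpower 2 x.
Proof. exact: exp_pos. Qed.

Lemma Rpower2_le (x y : R) : x <= y -> Rpower 2 x <= Rpower 2 y.
Proof. by move=> h; apply: Rle_Rpower => //; lra. Qed.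

Lemma Rpower2_leI (x y : R) : Rpower 2 x <= Rpower 2 y -> x <= y.
Proof.
move=> h; case: (Rle_lt_dec x y) => // hyx.
have : Rpower 2 y < Rpower 2 x by apply: Rpower_lt; lra.
lra.
Qed.

Lemma Rpower2_1 : Rpower 2 1 = 2.
Proof. by apply: Rpower_1; lra. Qed.

Lemma INR_archimed (x : R) : exists n : nat, x < INR n.
Proof.
case: (Rle_lt_dec x 0) => hx; first by exists 1%N => /=; lra.
exists (Z.to_nat (up x)); have [h1 _] := archimed x.
rewrite INR_IZR_INZ Z2Nat.id; first lra.
by apply: le_IZR; lra.
Qed.

(** If [r] exceeded [c], the ratio of the two powers would outgrow any constant. The factor 2 pays
    for discarding wrongly decoded pairs in the converse. *)
Lemma rate_le_of_eventually (r c : R) (n0 : nat) :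
  (forall n, (n0 <= n)%N -> Rpower 2 (INR n * r) <= 2 * Rpower 2 (INR n * c)) ->
  r <= c.
Proof.
move=> h; case: (Rle_lt_dec r c) => // hcr.
have [n hn] := INR_archimed (1 / (r - c)).
have hle : (n0 <= maxn n0 n)%N by apply: leq_maxl.
have := h _ hle; set k := maxn n0 n.
have -> : 2 * Rpower 2 (INR k * c) = Rpower 2 (1 + INR k * c).
  by rewrite Rpower_plus Rpower2_1.
move/Rpower2_leI => hk.
have hnk : INR n <= INR k by apply: INR_leq; apply: leq_maxr.
have : 1 / (r - c) * (r - c) < INR k * (r - c) by apply: Rmult_lt_compat_r; lra.
have -> : 1 / (r - c) * (r - c) = 1 by field; lra.
lra.
Qed.

(** Positivity of [x] makes [l * x < c]; the exponential growth of this gap absorbs [D]. *)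
Lemma eventually_rate_gap (x c l D : R) :
  0 < x -> x <= c -> 0 < l < 1 -> exists n0 : nat, forall n, (n0 <= n)%N ->
  D * Rpower 2 (INR n * (l * x)) <= Rpower 2 (INR n * c).
Proof.
move=> hx hxc hl.
have hgap : 0 < c - l * x by nra.
have [m hm] := INR_archimed D.
have [n0 hn0] := INR_archimed (INR m / (c - l * x)).
exists n0 => n hn.
have h1 : INR m <= INR n * (c - l * x).
  have : INR m / (c - l * x) * (c - l * x) <= INR n * (c - l * x).
    apply: Rmult_le_compat_r; first lra.
    by apply: Rle_trans (INR_leq hn); lra.
  have -> // : INR m / (c - l * x) * (c - l * x) = INR m by field; lra.
have h2 : D <= Rpower 2 (INR n * (c - l * x)).
  apply: Rle_trans (Rpower2_le h1); apply: Rle_trans (Rlt_le _ _ hm) _.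
  rewrite Rpower_pow; last lra.
  elim: m {hm hn0 h1} => [|m IH]; first by rewrite /=; lra.
  rewrite S_INR /=.
  have : 1 <= 2 ^ m by apply: pow_R1_Rle; lra.
  lra.
have -> : INR n * c = INR n * (c - l * x) + INR n * (l * x) by ring.
rewrite Rpower_plus; apply: Rmult_le_compat_r h2.
exact: Rlt_le (Rpower2_gt0 _).
Qed.

Lemma eventually_forall_fin (T : finType) (P : T -> nat -> Prop) :
  (forall i, exists n0, forall n, (n0 <= n)%N -> P i n) ->
  exists n0, forall n, (n0 <= n)%N -> forall i, P i n.
Proof.
move=> h; pose f i := proj1_sig (constructive_indefinite_description _ (h i)).
exists (\max_i f i)%N => n hn i.
apply: (proj2_sig (constructive_indefinite_description _ (h i))).
by apply: leq_trans hn; apply: leq_bigmax.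
Qed.

Lemma exists_ceil (y : R) : 0 < y -> exists M : nat, y <= INR M < y + 1.
Proof.
move=> hy; have [h1 h2] := archimed (- y).
exists (Z.to_nat (1 - up (- y))).
have h3 : IZR (1 - up (- y)) = 1 - IZR (up (- y)) by rewrite minus_IZR.
rewrite INR_IZR_INZ Z2Nat.id ?h3; first lra.
by apply: le_IZR; lra.
Qed.

(** * Capacities of families of links *)

Section Capacity.

Variables (K : nat) (N : {set 'I_K} -> nat).
Hypothesis hN : forall S : {set 'I_K}, S != set0 -> (0 < N S)%N.
Implicit Types W : {set {set 'I_K}}.

(** Bridge between rates and counting. The empty set is excluded because [N set0] is
    unconstrained. *)
Lemma Rpower2_capW (n : nat) W : set0 \notin W ->
  Rpower 2 (INR n * capW N W) = INR (\prod_(S in W) N S ^ n)%N.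
Proof.
move=> hW; rewrite /capW -big_enum /=.
have : all (fun S => S != set0) (enum W).
  by apply/allP => S; rewrite mem_enum => hS; apply: contraNneq hW => <-.
elim: (enum W) => [|S s IH] /=.
  by rewrite Rmult_0_r Rpower_O ?big_nil //; lra.
move=> /andP [hS hs]; rewrite big_cons Rmult_plus_distr_l Rpower_plus (IH hs).
rewrite INR_muln; congr (_ * _); rewrite INR_expn -Rpower_pow; last first.
  exact/lt_0_INR/ltP/hN.
rewrite /Rpower /cap; congr exp; field; exact: Rgt_not_eq ln2_gt0.
Qed.

Lemma capW_le W W' : set0 \notin W' -> W \subset W' -> capW N W <= capW N W'.
Proof.
move=> h0 hW; have h0' : set0 \notin W by apply: contra h0; apply: (subsetP hW).
rewrite -[X in X <= _]Rmult_1_l -[X in _ <= X]Rmult_1_l -[1]/(INR 1).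
apply: Rpower2_leI; rewrite !Rpower2_capW //; apply: INR_leq.
rewrite [X in (_ <= X)%N](big_setID W) /= (setIidPr hW).
rewrite -[X in (X <= _)%N]muln1 leq_mul2l; apply/orP; right.
apply: prodn_cond_gt0 => S; rewrite inE => /andP [_ hS].
by rewrite expn1 hN //; apply: contraNneq h0 => <-.
Qed.

Lemma capW_setU W W' : set0 \notin W -> set0 \notin W' -> [disjoint W & W'] ->
  capW N (W :|: W') = capW N W + capW N W'.
Proof.
move=> h h' hd; have hU : set0 \notin W :|: W' by rewrite inE negb_or h h'.
have e : Rpower 2 (INR 1 * capW N (W :|: W'))
       = Rpower 2 (INR 1 * (capW N W + capW N W')).
  rewrite Rmult_plus_distr_l Rpower_plus !Rpower2_capW // -INR_muln.
  by rewrite -bigU //; congr INR; apply: eq_bigl => S; rewrite !inE.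
have := Rpower2_leI (Req_le _ _ e); have := Rpower2_leI (Req_le_sym _ _ e).
by rewrite /= => *; lra.
Qed.

Lemma set0_Wset (i : 'I_K) : set0 \notin Wset i.
Proof. by rewrite !inE eqxx. Qed.

Lemma in_Wset (i : 'I_K) (S : {set 'I_K}) : (S \in Wset i) = (i \in S).
Proof. by rewrite inE andb_idl //; apply: in_set_neq0. Qed.

End Capacity.
(** * Converse *)

Section Converse.

Variables (K : nat) (N : {set 'I_K} -> nat).

(* Link values are flattened to naturals because the alphabets depend on [S]. *)
Definition link_value (x : Xin N) (S : {set 'I_K}) : nat :=
  if Bool.bool_dec (S != set0) true is left h then nat_of_ord (x S h) else 0%N.

Lemma link_valueE (x : Xin N) (S : {set 'I_K}) (h : S != set0) :
  link_value x S = x S h.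
Proof.
rewrite /link_value; case: Bool.bool_dec => [h'|] //.
by rewrite (eq_irrelevance h' h).
Qed.

(** The side information [e m] and the symbols on the links of [W] identify [m] within [G], which
    gives an injection. *)
Lemma card_le_links (n : nat) (W : {set {set 'I_K}}) (T E : finType)
    (G : {set T}) (e : T -> E) (X : T -> 'I_n -> Xin N) :
  set0 \notin W ->
  (forall m m', m \in G -> m' \in G -> e m = e m' ->
     (forall t S (h : S != set0), S \in W -> X m t S h = X m' t S h) -> m = m') ->
  (#|G| <= #|E| * \prod_(S in W) N S ^ n)%N.
Proof.
(* [B] bounds all alphabets, so every symbol fits in one type. Links outside [W] carry the default
   [ord0] and count as a factor one. *)
move=> h0 hinj; pose B := (\max_S N S)%N.
pose F m : E * {ffun {set 'I_K} * 'I_n -> 'I_B.+1} :=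
  (e m, [ffun st => if st.1 \in W then inord (link_value (X m st.2) st.1) else ord0]).
have hlt m t S (h : S != set0) : (X m t S h < B.+1)%N.
  by apply: ltnW; apply: leq_ltn_trans (ltn_ord _) _; rewrite ltnS; apply: leq_bigmax.
pose A (st : {set 'I_K} * 'I_n) : pred 'I_B.+1 :=
  fun v => if st.1 \in W then (v < N st.1)%N else v == ord0.
have injF : {in G &, injective F}.
  move=> m m' hm hm' [he /ffunP hF]; apply: hinj => // t S h hS.
  have := hF (S, t); rewrite !ffunE /= hS !(link_valueE _ h) => /(congr1 (@nat_of_ord _)).
  by rewrite !inordK // => hv; apply: val_inj.
rewrite -(card_in_imset injF).
have hsub : F @: G \subset setX [set: E] [set f | f \in family A].
  apply/subsetP => _ /imsetP [m _ ->]; rewrite in_setX !in_set /=.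
  apply/familyP => -[S t]; rewrite !ffunE unfold_in /A /=.
  case: (boolP (S \in W)) => hS; last by rewrite eqxx.
  have h : S != set0 by apply: contraNneq h0 => <-.
  by rewrite (link_valueE _ h) inordK.
apply: leq_trans (subset_leq_card hsub) _.
rewrite cardsX cardsT cardsE leq_mul2l card_family foldrE big_map big_enum /=.
apply/orP; right.
rewrite -(pair_bigA _ (fun S t => #|A (S, t)|)) /= [X in (_ <= X)%N]big_mkcond /=.
apply: leq_prod => S _.
have hA t : (#|A (S, t)| <= if S \in W then N S else 1)%N.
  rewrite /A /=; case: ifP => _; last by rewrite card1.
  rewrite cardE -(size_map val) -[X in (_ <= X)%N](size_iota 0).
  apply: uniq_leq_size; first by rewrite (map_inj_uniq val_inj) enum_uniq.
  by move=> v /mapP [u]; rewrite mem_enum unfold_in => hu ->; rewrite mem_iota.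
apply: leq_trans (leq_prod (fun t _ => hA t)) _.
by rewrite big_const_ord iter_muln_1; case: ifP => //; rewrite exp1n.
Qed.

(** * Counting bounds for one fixed code *)

Section Code.

Variables (DA DB : {set 'I_K}) (n MA MB : nat).
Variable enc : 'I_MA -> 'I_MB -> 'I_n -> Xin N.
Variable decA : forall i : 'I_K, ('I_n -> Yout N i) -> 'I_MA.
Variable decB : forall i : 'I_K, ('I_n -> Yout N i) -> 'I_MB.

Definition good := ~: [set m | err_event DA DB enc decA decB m].

Lemma output_eq (i : 'I_K) (W : {set {set 'I_K}}) (m m' : 'I_MA * 'I_MB) :
  Wset i \subset W ->
  (forall t S (h : S != set0), S \in W ->
     enc m.1 m.2 t h = enc m'.1 m'.2 t h) ->
  (fun t => chan (enc m.1 m.2 t)) = (fun t => @chan K N i (enc m'.1 m'.2 t)).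
Proof.
move=> hW hX; apply: functional_extensionality_dep => t.
apply: functional_extensionality_dep => S.
apply: functional_extensionality_dep => hS; apply: hX.
by apply: (subsetP hW); rewrite in_Wset.
Qed.

Lemma good_decA (i : 'I_K) m : i \in DA -> m \in good ->
  decA (fun t => @chan K N i (enc m.1 m.2 t)) = m.1.
Proof.
move=> hi; rewrite !inE negb_exists => /forallP /(_ i).
by rewrite hi negb_or /= negbK => /andP [/eqP].
Qed.

Lemma good_decB (i : 'I_K) m : i \in DB -> m \in good ->
  decB (fun t => @chan K N i (enc m.1 m.2 t)) = m.2.
Proof.
move=> hi; rewrite !inE negb_exists => /forallP /(_ i).
by rewrite hi negb_or /= negbK => /andP [_ /eqP].
Qed.

(** The second message serves as side information; its factor [MB] later cancels against the number
    [MA * MB] of pairs. *)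
Lemma good_le_A (i : 'I_K) : i \in DA ->
  (#|good| <= MB * \prod_(S in Wset i) N S ^ n)%N.
Proof.
move=> hi; rewrite -[X in (_ <= X * _)%N]card_ord.
apply: (card_le_links (e := snd) (X := fun m => enc m.1 m.2) (set0_Wset i)).
move=> m m' hm hm' e2 /(output_eq (subxx _)) hY.
have := good_decA hi hm; rewrite hY (good_decA hi hm').
by case: m m' e2 {hm hm' hY} => [a b] [a' b'] /= -> ->.
Qed.

Lemma good_le_B (i : 'I_K) : i \in DB ->
  (#|good| <= MA * \prod_(S in Wset i) N S ^ n)%N.
Proof.
move=> hi; rewrite -[X in (_ <= X * _)%N]card_ord.
apply: (card_le_links (e := fst) (X := fun m => enc m.1 m.2) (set0_Wset i)).
move=> m m' hm hm' e1 /(output_eq (subxx _)) hY.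
have := good_decB hi hm; rewrite hY (good_decB hi hm').
by case: m m' e1 {hm hm' hY} => [a b] [a' b'] /= -> ->.
Qed.

(** Receivers [i] and [j] pool their outputs and recover both messages, so the side information is
    constant. *)
Lemma good_le_AB (i j : 'I_K) : i \in DA -> j \in DB ->
  (#|good| <= \prod_(S in Wset i :|: Wset j) N S ^ n)%N.
Proof.
move=> hi hj; have h0 : set0 \notin Wset i :|: Wset j.
  by rewrite inE negb_or !set0_Wset.
rewrite -[X in (_ <= X)%N]mul1n -[X in (_ <= X * _)%N]card_unit.
apply: (card_le_links (e := fun=> tt) (X := fun m => enc m.1 m.2) h0).
move=> m m' hm hm' _ hX.
have := good_decA hi hm; rewrite (output_eq (subsetUl _ _) hX) (good_decA hi hm').
have := good_decB hj hm; rewrite (output_eq (subsetUr _ _) hX) (good_decB hj hm').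
by case: m m' {hm hm' hX} => [a b] [a' b'] /= -> ->.
Qed.

Lemma good_ge_half : (0 < MA)%N -> (0 < MB)%N ->
  Perr DA DB enc decA decB <= 1 / 2 -> INR MA * INR MB <= 2 * INR #|good|.
Proof.
move=> hA hB; rewrite /Perr INR_muln => hP.
have pA : 0 < INR MA by apply/lt_0_INR/ltP.
have pB : 0 < INR MB by apply/lt_0_INR/ltP.
have pAB := Rmult_lt_0_compat _ _ pA pB.
have hE : INR #|[set m | err_event DA DB enc decA decB m]| <= 1 / 2 * (INR MA * INR MB).
  have := Rmult_le_compat_r _ _ _ (Rlt_le _ _ pAB) hP.
  by rewrite /Rdiv Rmult_assoc Rinv_l; lra.
have : INR (#|[set m | err_event DA DB enc decA decB m]| + #|good|)%N = INR MA * INR MB.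
  by rewrite cardsC card_prod !card_ord INR_muln.
by rewrite plus_INR; lra.
Qed.

End Code.

Hypothesis hN : forall S : {set 'I_K}, S != set0 -> (0 < N S)%N.

(** Error probability at most 1/2 leaves at least half of the pairs correctly decoded; counting
    these bounds the rates up to the factor 2. *)
Lemma achievable_le (DA DB : {set 'I_K}) (a b : R) : achievable N DA DB a b ->
  [/\ forall i, i \in DA -> a <= capW N (Wset i),
      forall i, i \in DB -> b <= capW N (Wset i)
    & forall i j, i \in DA -> j \in DB -> a + b <= capW N (Wset i :|: Wset j)].
Proof.
move=> [ha [hb /(_ (1 / 2)) []]]; first lra.
move=> n0 hn0; split.
- move=> i hi; apply: (@rate_le_of_eventually _ _ n0) => n /hn0.
  move=> [MA [MB [hMA [hMB [enc [decA [decB hP]]]]]]].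
  have pA := Rpower2_gt0 (INR n * a); have pB := Rpower2_gt0 (INR n * b).
  have MA0 : (0 < MA)%N by apply: ltn_INR => /=; lra.
  have MB0 : (0 < MB)%N by apply: ltn_INR => /=; lra.
  have hG := good_ge_half MA0 MB0 hP.
  have := INR_leq (good_le_A DB enc decA decB hi).
  rewrite INR_muln -Rpower2_capW ?set0_Wset // => hG'.
  have {}hG : INR MA * INR MB <= 2 * (INR MB * Rpower 2 (INR n * capW N (Wset i))).
    by lra.
  apply: Rle_trans (proj1 hMA) _; apply: (@Rmult_le_reg_r (INR MB)); lra.
- move=> i hi; apply: (@rate_le_of_eventually _ _ n0) => n /hn0.
  move=> [MA [MB [hMA [hMB [enc [decA [decB hP]]]]]]].
  have pA := Rpower2_gt0 (INR n * a); have pB := Rpower2_gt0 (INR n * b).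
  have MA0 : (0 < MA)%N by apply: ltn_INR => /=; lra.
  have MB0 : (0 < MB)%N by apply: ltn_INR => /=; lra.
  have hG := good_ge_half MA0 MB0 hP.
  have := INR_leq (good_le_B DA enc decA decB hi).
  rewrite INR_muln -Rpower2_capW ?set0_Wset // => hG'.
  have {}hG : INR MA * INR MB <= 2 * (INR MA * Rpower 2 (INR n * capW N (Wset i))).
    by lra.
  apply: Rle_trans (proj1 hMB) _; apply: (@Rmult_le_reg_l (INR MA)); lra.
- move=> i j hi hj; apply: (@rate_le_of_eventually _ _ n0) => n /hn0.
  move=> [MA [MB [hMA [hMB [enc [decA [decB hP]]]]]]].
  have pA := Rpower2_gt0 (INR n * a); have pB := Rpower2_gt0 (INR n * b).
  have MA0 : (0 < MA)%N by apply: ltn_INR => /=; lra.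
  have MB0 : (0 < MB)%N by apply: ltn_INR => /=; lra.
  have hG := good_ge_half MA0 MB0 hP.
  have := INR_leq (good_le_AB enc decA decB hi hj).
  rewrite -Rpower2_capW ?in_setU ?negb_or ?set0_Wset //.
  move=> hG'; rewrite Rmult_plus_distr_l Rpower_plus.
  apply: Rle_trans (Rle_trans _ _ _ hG _); last lra.
  by apply: Rmult_le_compat; lra.
Qed.

End Converse.

(** * Random codebooks *)

(** Overwriting [g x] by any symbol loses nothing when [g x = g y], since the old value survives at
    [y]. *)
Lemma card_collision_le (T : finType) (q : nat) (x y : T) : x != y ->
  (q * #|[set g : {ffun T -> 'I_q} | g x == g y]| <= #|{ffun T -> 'I_q}|)%N.
Proof.
move=> hxy; pose B := [set g : {ffun T -> 'I_q} | g x == g y].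
pose F (cg : 'I_q * {ffun T -> 'I_q}) := [ffun z => if z == x then cg.1 else cg.2 z].
have injF : {in setX [set: 'I_q] B &, injective F}.
  move=> [c g] [c' g']; rewrite !in_setX !inE /= => /eqP hg /eqP hg' /ffunP h.
  congr (_, _); first by have := h x; rewrite !ffunE eqxx.
  apply/ffunP => z; have := h z; rewrite !ffunE /=.
  case: eqVneq => [-> _|] //; rewrite hg hg'.
  by have := h y; rewrite !ffunE eq_sym (negbTE hxy).
have := subset_leq_card (subsetT (F @: setX [set: 'I_q] B)).
by rewrite (card_in_imset injF) cardsX !cardsT card_ord.
Qed.

Lemma exists_le_average (T : finType) (f : T -> nat) (c : nat) :
  (0 < #|T|)%N -> (\sum_x f x <= #|T| * c)%N -> exists x, (f x <= c)%N.
Proof.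
move=> hT hsum; case: (boolP [exists x, (f x <= c)%N]) => [/existsP //|].
rewrite negb_exists => /forallP hall.
have : (\sum_(x : T) c.+1 <= \sum_x f x)%N.
  by apply: leq_sum => x _; have := hall x; rewrite -ltnNge.
rewrite sum_nat_const => /leq_trans /(_ hsum).
by rewrite leq_mul2l ltnn orbF => /eqP h0; rewrite h0 in hT.
Qed.

(** First-moment argument over a uniform [g]: distinct keys collide with probability at most 1/q,
    equal keys always, and some [g] does no worse than average. *)
Lemma exists_hash (P T : finType) (k k' : P -> T) (q : nat) (w : P -> nat) :
  (0 < q)%N -> exists g : {ffun T -> 'I_q},
  (q * \sum_p w p * (g (k p) == g (k' p))
     <= \sum_p w p * (if k p == k' p then q else 1))%N.
Proof.
move=> hq; apply: exists_le_average.
  by rewrite card_ffun card_ord expn_gt0 hq.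
rewrite -big_distrr exchange_big !big_distrr /=; apply: leq_sum => p _.
rewrite -big_distrr /= mulnCA [X in (_ <= X)%N]mulnCA leq_mul2l; apply/orP; right.
case: eqVneq => [->|hp].
  by rewrite mulnC leq_mul2r (eq_bigr (fun=> 1%N)) ?sum1_card ?leqnn ?orbT // => g; rewrite eqxx.
rewrite muln1; apply: leq_trans (card_collision_le q hp).
rewrite leq_mul2l -sum1_card [X in (_ <= X)%N]big_mkcond /=; apply/orP; right.
by apply: leq_sum => g _; rewrite inE; case: eqP.
Qed.

(* The codebooks are fixed one link at a time: the links in [s] not yet fixed
   contribute their expected collision probability to the weights. *)
Lemma exists_codebook (I : eqType) (s : seq I) (P T : finType)
    (k k' : I -> P -> T) (q : I -> nat) (w : P -> nat) :
  uniq s -> (forall i, 0 < q i)%N ->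
  exists g : I -> T -> nat, (forall i x, g i x < q i)%N /\
  ((\prod_(i <- s) q i) * \sum_p w p * \prod_(i <- s) (g i (k i p) == g i (k' i p))
     <= \sum_p w p * \prod_(i <- s) (if k i p == k' i p then q i else 1))%N.
Proof.
move=> us hq; elim: s us w => [_ w|i s IH /= /andP [his us] w].
  exists (fun _ _ => 0%N); split=> //; rewrite !big_nil mul1n.
  by apply: leq_sum => p _; rewrite !big_nil.
pose W p := (w p * \prod_(j <- s) (if k j p == k' j p then q j else 1))%N.
have [h hh] := exists_hash (k i) (k' i) W (hq i).
(* Once [h] is fixed, only the pairs that it fails to separate keep their weight for the remaining
   links. *)
have [g [hg IHg]] := IH us (fun p => w p * (h (k i p) == h (k' i p)))%N.
exists (fun j x => if j == i then nat_of_ord (h x) else g j x); split.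
  by move=> j x; case: eqVneq => [->|].
have hne j : j \in s -> (j == i) = false.
  by move=> hj; apply/negbTE; apply: contraNneq his => <-.
rewrite big_cons -mulnA.
apply: (@leq_trans (q i * \sum_p W p * (h (k i p) == h (k' i p)))); last first.
  apply: leq_trans hh _; apply: eq_leq; apply: eq_bigr => p _.
  by rewrite big_cons /W mulnAC mulnA.
rewrite leq_mul2l; apply/orP; right; apply: (leq_trans _ (leq_trans IHg _)).
  apply: eq_leq; congr (_ * _)%N; apply: eq_bigr => p _; rewrite big_cons eqxx mulnA.
  by congr (_ * _)%N; rewrite big_seq [RHS]big_seq; apply: eq_bigr => j /hne ->.
by apply: eq_leq; apply: eq_bigr => p _; rewrite /W mulnAC.
Qed.

(** * Random codes with common and private message parts *)

Section RandomCode.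

Variables (K : nat) (rK rK1 : 'I_K) (q : {set 'I_K} -> nat).
Hypothesis hq : forall S, (0 < q S)%N.
Variables (X A B : finType).
Local Notation msg := (X * A * B)%type.
Implicit Types (m : msg) (i : 'I_K) (S : {set 'I_K}).

(* Link [S] must hide the private part of the first message from receiver [rK]
   and the private part of the second one from receiver [rK1]. *)
Definition key S m : X * option A * option B :=
  (m.1.1, if rK \in S then None else Some m.1.2, if rK1 \in S then None else Some m.2).

(** Receiver [rK] neither sees nor requires the private part of the first message, so its competing
    candidates may be taken with the true value there; likewise [altB] for [rK1]. *)
Definition altA i (a : A) : {set A} := if i == rK then [set a] else setT.
Definition altB i (b : B) : {set B} := if i == rK1 then [set b] else setT.
Definition nA i := if i == rK then 1%N else #|A|.
Definition nB i := if i == rK1 then 1%N else #|B|.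

Definition rival i m m' : bool :=
  [&& m != m', m'.1.2 \in altA i m.1.2 & m'.2 \in altB i m.2].

Lemma card_altA i a : #|altA i a| = nA i.
Proof. by rewrite /altA /nA; case: ifP; rewrite ?cards1 ?cardsT. Qed.

Lemma card_altB i b : #|altB i b| = nB i.
Proof. by rewrite /altB /nB; case: ifP; rewrite ?cards1 ?cardsT. Qed.

Lemma card_altAD i a : #|altA i a :\ a| = (nA i - 1)%N.
Proof.
have ha : a \in altA i a by rewrite /altA; case: ifP; rewrite inE.
by rewrite -(card_altA i a) [in RHS](cardsD1 a) ha add1n subn1.
Qed.

Lemma card_altBD i b : #|altB i b :\ b| = (nB i - 1)%N.
Proof.
have hb : b \in altB i b by rewrite /altB; case: ifP; rewrite inE.
by rewrite -(card_altB i b) [in RHS](cardsD1 b) hb add1n subn1.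
Qed.

(* [Q * Pr(m and m' collide at i)], where [Q] is the product of all [q S] *)
Definition collision_weight i m m' : nat :=
  (\prod_(S : {set 'I_K}) if (i \in S) && (key S m != key S m') then 1 else q S)%N.

(** Links of [U] always separate, so each weight is at most the product of [q] outside [U]; the
    product over [U] pays for the size of the class. *)
Lemma sum_collision_weight_le Z i m (U : {set {set 'I_K}}) SX SA SB :
  (forall m', m' \in setX (setX SX SA) SB -> forall S, S \in U ->
     (i \in S) && (key S m != key S m')) ->
  (Z * (#|SX| * #|SA| * #|SB|) <= \prod_(S in U) q S)%N ->
  (Z * \sum_(m' in setX (setX SX SA) SB) collision_weight i m m' <= \prod_S q S)%N.
Proof.
move=> hU hZ.
have hw m' : m' \in setX (setX SX SA) SB ->
    (collision_weight i m m' <= \prod_(S in ~: U) q S)%N.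
  move=> hm'; rewrite big_mkcond /=; apply: leq_prod => S _; rewrite inE.
  by case: (boolP (S \in U)) => [/(hU _ hm') ->|_] //=; case: ifP.
apply: leq_trans (_ : Z * \sum_(m' in setX (setX SX SA) SB) \prod_(S in ~: U) q S <= _)%N.
  by rewrite leq_mul2l leq_sum ?orbT.
rewrite sum_nat_const !cardsX mulnA.
have -> : (\prod_S q S = (\prod_(S in U) q S) * \prod_(S in ~: U) q S)%N.
  rewrite (bigID (mem U)) /=; congr (_ * _)%N.
  by apply: eq_bigl => S; rewrite inE.
by rewrite leq_mul2r hZ orbT.
Qed.

(** The error probability will be at most 4K/Z. The four conditions treat, in order, a wrong common
    part, both private parts wrong, only the first wrong, only the second wrong. *)
Variable Z : nat.
Hypothesis hZ1 : forall i,
  (Z * ((#|X| - 1) * nA i * nB i) <= \prod_(S in Wset i) q S)%N.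
Hypothesis hZ2 : forall i, (Z * ((nA i - 1) * (nB i - 1)) <=
  \prod_(S in [set S in Wset i | ~~ ((rK \in S) && (rK1 \in S))]) q S)%N.
Hypothesis hZ3 : forall i,
  (Z * (nA i - 1) <= \prod_(S in [set S in Wset i | rK \notin S]) q S)%N.
Hypothesis hZ4 : forall i,
  (Z * (nB i - 1) <= \prod_(S in [set S in Wset i | rK1 \notin S]) q S)%N.

(** One term per class of rivals, hence the 4. A wrong common part alters the key of every link, a
    wrong first private part those avoiding [rK], a wrong second one those avoiding [rK1]. *)
Lemma sum_rival_le i m :
  (Z * \sum_(m' | rival i m m') collision_weight i m m' <= 4 * \prod_S q S)%N.
Proof.
case: m => [[x a] b]; set m := (x, a, b).
pose C1 := setX (setX [set~ x] (altA i a)) (altB i b).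
pose C2 := setX (setX [set x] (altA i a :\ a)) (altB i b :\ b).
pose C3 := setX (setX [set x] (altA i a :\ a)) [set b].
pose C4 := setX (setX [set x] [set a]) (altB i b :\ b).
have h1 : (Z * \sum_(m' in C1) collision_weight i m m' <= \prod_S q S)%N.
  apply: (@sum_collision_weight_le _ _ _ (Wset i)).
    move=> [[x' a'] b']; rewrite !inE /= => /andP [/andP [hx _] _] S.
    rewrite in_Wset => -> /=.
    by apply: contra hx => /eqP [->].
  by rewrite cardsC1 -subn1 card_altA card_altB.
have h2 : (Z * \sum_(m' in C2) collision_weight i m m' <= \prod_S q S)%N.
  apply: (@sum_collision_weight_le _ _ _ _ _ _ _ _ _ ); last first.
    by rewrite cards1 mul1n card_altAD card_altBD; apply: hZ2.
  move=> [[x' a'] b']; rewrite !inE /=.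
  move=> /andP [/andP [_ /andP [ha _]] /andP [hb _]] S; rewrite !inE.
  move=> /andP [/andP [_ ->]] /=; apply: contra.
  by rewrite /key /=; case: (rK \in S) (rK1 \in S) => [] [] // /eqP [] *; subst; rewrite ?eqxx in ha hb.
have h3 : (Z * \sum_(m' in C3) collision_weight i m m' <= \prod_S q S)%N.
  apply: (@sum_collision_weight_le _ _ _ _ _ _ _ _ _ ); last first.
    by rewrite !cards1 mul1n muln1 card_altAD; apply: hZ3.
  move=> [[x' a'] b']; rewrite !inE /=.
  move=> /andP [/andP [_ /andP [ha _]] _] S; rewrite !inE.
  move=> /andP [/andP [_ ->] hS] /=; rewrite /key /= (negbTE hS).
  by apply: contra ha => /eqP [_ -> _].
have h4 : (Z * \sum_(m' in C4) collision_weight i m m' <= \prod_S q S)%N.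
  apply: (@sum_collision_weight_le _ _ _ _ _ _ _ _ _ ); last first.
    by rewrite !cards1 !mul1n card_altBD; apply: hZ4.
  move=> [[x' a'] b']; rewrite !inE /=.
  move=> /andP [_ /andP [hb _]] S; rewrite !inE.
  move=> /andP [/andP [_ ->] hS] /=; rewrite /key /= (negbTE hS).
  by apply: contra hb => /eqP [_ _ ->].
have hsplit : (\sum_(m' | rival i m m') collision_weight i m m' <=
    \sum_(m' in C1) collision_weight i m m' + \sum_(m' in C2) collision_weight i m m'
  + \sum_(m' in C3) collision_weight i m m' + \sum_(m' in C4) collision_weight i m m')%N.
  rewrite big_mkcond [X in (_ <= X + _ + _ + _)%N]big_mkcond.
  rewrite [X in (_ <= _ + X + _ + _)%N]big_mkcond [X in (_ <= _ + _ + X + _)%N]big_mkcond.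
  rewrite [X in (_ <= _ + _ + _ + X)%N]big_mkcond -!big_split /=.
  apply: leq_sum => -[[x' a'] b'] _; case: ifP => // /and3P [/= hm ha hb].
  rewrite !in_setX !inE ha hb /= !andbT.
  case: (eqVneq x' x) => [ex|hx] /=; last by rewrite -!addnA leq_addr.
  case: (eqVneq a' a) => [ea|hxa]; case: (eqVneq b' b) => [eb|hxb] /=.
  - by rewrite /m ex ea eb eqxx in hm.
  - by rewrite leq_addl.
  - by rewrite !add0n addn0.
  - by rewrite add0n !addn0.
apply: leq_trans (leq_mul (leqnn Z) hsplit) _; rewrite !mulnDr.
by rewrite !mulSn mul0n addn0 !addnA !leq_add.
Qed.

(** Only elements of [D] are sent, but rivals range over all of [msg], because exchanging a private
    part may lead outside [D]. *)
Lemma exists_random_code (D : {set msg}) :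
  exists g : {set 'I_K} -> X * option A * option B -> nat,
  (forall S x, g S x < q S)%N /\
  (Z * #|[set p : 'I_K * (msg * msg) | [&& p.2.1 \in D, rival p.1 p.2.1 p.2.2 &
      [forall S : {set 'I_K}, (p.1 \in S) ==> (g S (key S p.2.1) == g S (key S p.2.2))]]]|
   <= 4 * (K * #|D|))%N.
Proof.
(* A link unseen by the receiver gets [None] on both sides and so always collides, in agreement with
   [collision_weight]. *)
pose k (S : {set 'I_K}) (p : 'I_K * (msg * msg)) := if p.1 \in S then Some (key S p.2.1) else None.
pose k' (S : {set 'I_K}) (p : 'I_K * (msg * msg)) := if p.1 \in S then Some (key S p.2.2) else None.
pose w (p : 'I_K * (msg * msg)) := ((p.2.1 \in D) && rival p.1 p.2.1 p.2.2) : nat.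
have [g [hg hle]] := exists_codebook k k' w (index_enum_uniq {set 'I_K}) hq.
exists (fun S x => g S (Some x)); split=> //.
set E := [set p | _].
have hQ : (0 < \prod_S q S)%N by apply: prodn_gt0.
rewrite -(leq_pmul2l hQ) mulnCA.
have hE : (#|E| <= \sum_p w p * \prod_S (g S (k S p) == g S (k' S p)))%N.
  rewrite -sum1_card big_mkcond /=; apply: leq_sum => p _; case: ifP => //.
  rewrite inE => /and3P [hD hr /forallP hm]; rewrite /w hD hr mul1n.
  rewrite big1 // => S _; have := hm S; rewrite /k /k'; case: ifP => _ /=.
    by move=> ->.
  by rewrite eqxx.
apply: leq_trans (leq_mul (leqnn Z) (leq_mul (leqnn _) hE)) _.
apply: leq_trans (leq_mul (leqnn Z) hle) _.
have -> : (\sum_p w p * \prod_S (if k S p == k' S p then q S else 1) =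
    \sum_i \sum_(m in D) \sum_(m' | rival i m m') collision_weight i m m')%N.
  rewrite -(pair_bigA _ (fun i mm => w (i, mm) * \prod_S (if k S (i, mm) == k' S (i, mm) then q S else 1)))%N /=.
  apply: eq_bigr => i _.
  rewrite -(pair_bigA _ (fun m m' => w (i, (m, m')) * \prod_S (if k S (i, (m, m')) == k' S (i, (m, m')) then q S else 1)))%N /=.
  rewrite [RHS]big_mkcond /=; apply: eq_bigr => m _; rewrite /w /=.
  case: (m \in D) => /=; last by rewrite big1.
  rewrite [RHS]big_mkcond /=; apply: eq_bigr => m' _.
  case: (rival i m m'); rewrite ?mul0n // mul1n; apply: eq_bigr => S _.
  rewrite /k /k' /=; case: (i \in S) => //=.
  by rewrite (inj_eq Some_inj); case: eqP.
rewrite big_distrr /=; apply: leq_trans (_ : \sum_(i < K) #|D| * (4 * \prod_S q S) <= _)%N.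
  apply: leq_sum => i _; rewrite big_distrr /= -sum_nat_const; apply: leq_sum => m _.
  exact: sum_rival_le.
by rewrite sum_nat_const card_ord mulnA mulnA [X in (_ <= X)%N]mulnC [X in (X * _ <= _)%N]mulnC.
Qed.

End RandomCode.

(** * Achievability *)

(** Allows one codebook value to be spread over [n] channel uses as base [q] digits; the induction
    peels off the last digit. *)
Lemma eq_of_digits (q n a b : nat) : (a < q ^ n)%N -> (b < q ^ n)%N ->
  (forall t, (t < n)%N -> (a %/ q ^ t %% q)%N = (b %/ q ^ t %% q)%N) -> a = b.
Proof.
elim: n a b => [|n IH] a b; first by rewrite !ltnS !leqn0 => /eqP -> /eqP ->.
rewrite !expnSr => ha hb h.
have hq : (0 < q)%N by case: (q) ha => //; rewrite muln0.
rewrite (divn_eq a q) (divn_eq b q); congr (_ * _ + _)%N; last first.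
  by have := h 0%N isT; rewrite expn0 !divn1.
apply: IH; rewrite ?ltn_divLR // => t ht.
by have := h t.+1 ht; rewrite expnS !divnMA.
Qed.

Lemma exists_inj_ord (T : finType) (M : nat) : (M <= #|T|)%N ->
  exists f : 'I_M -> T, injective f.
Proof.
move=> hM; exists (fun x => enum_val (widen_ord hM x)) => x y /enum_val_inj.
by move/(congr1 val) => /= /val_inj.
Qed.

Section Achievability.

Variables (K : nat) (N : {set 'I_K} -> nat).
Hypothesis hN : forall S : {set 'I_K}, S != set0 -> (0 < N S)%N.
Variables (rK rK1 : 'I_K).

(* [N set0] is arbitrary, possibly [0]. *)
Definition block_size (n : nat) (S : {set 'I_K}) : nat :=
  if S == set0 then 1%N else (N S ^ n)%N.

Lemma block_size_gt0 n S : (0 < block_size n S)%N.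
Proof. by rewrite /block_size; case: eqVneq => // /hN h; rewrite expn_gt0 h. Qed.

Lemma prod_block_size n (W : {set {set 'I_K}}) : set0 \notin W ->
  INR (\prod_(S in W) block_size n S)%N = Rpower 2 (INR n * capW N W).
Proof.
move=> h0; rewrite Rpower2_capW //; congr INR; apply: eq_bigr => S hS.
by rewrite /block_size; case: eqVneq => // e; rewrite -e hS in h0.
Qed.

(** Link [S] sends the base [N S] digits of its codebook value. The decoder picks any pair
    consistent with the output, so an error at [i] exhibits a rival colliding on every link that [i]
    sees. *)
Lemma exists_code (n MA MB Z : nat) (X1 X2 A B : finType)
    (fA : 'I_MA -> X1 * A) (fB : 'I_MB -> X2 * B) :
  (0 < MA)%N -> (0 < MB)%N -> injective fA -> injective fB ->
  (forall i, Z * ((#|{: X1 * X2}| - 1) * nA rK A i * nB rK1 B i) <=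
     \prod_(S in Wset i) block_size n S)%N ->
  (forall i, Z * ((nA rK A i - 1) * (nB rK1 B i - 1)) <=
     \prod_(S in [set S in Wset i | ~~ ((rK \in S) && (rK1 \in S))]) block_size n S)%N ->
  (forall i, Z * (nA rK A i - 1) <=
     \prod_(S in [set S in Wset i | rK \notin S]) block_size n S)%N ->
  (forall i, Z * (nB rK1 B i - 1) <=
     \prod_(S in [set S in Wset i | rK1 \notin S]) block_size n S)%N ->
  exists (enc : 'I_MA -> 'I_MB -> 'I_n -> Xin N)
         (decA : forall i : 'I_K, ('I_n -> Yout N i) -> 'I_MA)
         (decB : forall i : 'I_K, ('I_n -> Yout N i) -> 'I_MB),
    (Z * #|[set m | err_event (cmpl [set rK]) (cmpl [set rK1]) enc decA decB m]|
       <= 4 * (K * (MA * MB)))%N.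
Proof.
move=> hMA hMB injA injB hZ1 hZ2 hZ3 hZ4.
pose phi (m : 'I_MA * 'I_MB) : X1 * X2 * A * B :=
  ((fA m.1).1, (fB m.2).1, (fA m.1).2, (fB m.2).2).
have injphi : injective phi.
  move=> [a b] [a' b'] [/= h1 h2 h3 h4]; congr (_, _).
    by apply: injA; rewrite [LHS]surjective_pairing h1 h3 -surjective_pairing.
  by apply: injB; rewrite [LHS]surjective_pairing h2 h4 -surjective_pairing.
have [g [hg hbad]] :=
  exists_random_code (block_size_gt0 n) hZ1 hZ2 hZ3 hZ4 (phi @: setT).
pose enc mA mB (t : 'I_n) : Xin N := fun S h =>
  Ordinal (ltn_pmod (g S (key rK rK1 S (phi (mA, mB))) %/ N S ^ t) (hN h)).
pose out i m := fun t => @chan K N i (enc m.1 m.2 t).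
(* The sent pair is itself consistent, so the choice reproduces the output; it is arbitrary on
   outputs that no pair produces. *)
pose dec i y := epsilon (inhabits (Ordinal hMA, Ordinal hMB)) (fun m => out i m = y).
have hdec i m : out i (dec i (out i m)) = out i m.
  by apply: (epsilon_spec _ (fun m' => out i m' = out i m)); exists m.
have hout i m m' (S : {set 'I_K}) : out i m = out i m' -> i \in S ->
    g S (key rK rK1 S (phi m)) = g S (key rK rK1 S (phi m')).
  move=> ho hS; have h0 := in_set_neq0 hS.
  have hlt k : (g S k < N S ^ n)%N.
    by have := hg S k; rewrite /block_size (negbTE h0).
  apply: (eq_of_digits (hlt _) (hlt _)) => t ht.
  have := congr1 (fun y => nat_of_ord (y (Ordinal ht) S hS)) ho.
  by case: m m' {ho} => [a b] [a' b'].
exists enc, (fun i y => (dec i y).1), (fun i y => (dec i y).2).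
rewrite card_imset // cardsT card_prod !card_ord in hbad.
apply: leq_trans hbad; rewrite leq_mul2l; apply/orP; right.
rewrite -(card_imset _ injphi).
apply: leq_trans (leq_imset_card (fun p => p.2.1) _); apply: subset_leq_card.
apply/subsetP => _ /imsetP [m hm ->]; move: hm; rewrite inE => /existsP [i herr].
pose m' := dec i (out i m).
have {}herr : ((i != rK) && (m'.1 != m.1)) || ((i != rK1) && (m'.2 != m.2)).
  by move: herr; rewrite !inE /m'; case: (m).
(* Restoring the true value of a part hidden from [i] turns the decoded pair into a rival. The keys
   seen by [i] do not change, and the error persists since it concerns a message that [i]
   requires. *)
pose mu := (((phi m').1.1, if i == rK then (phi m).1.2 else (phi m').1.2),
            if i == rK1 then (phi m).2 else (phi m').2).
apply/imsetP; exists (i, (phi m, mu)) => //; rewrite inE /= imset_f //=.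
apply/andP; split.
  apply/and3P; split; rewrite /mu /=.
  - apply/eqP => -[h1 h2 h3 h4]; case/orP: herr => /andP [hi hne].
      rewrite (negbTE hi) in h3; move/eqP: hne; apply; apply: injA.
      by rewrite [LHS]surjective_pairing -h1 -h3 -surjective_pairing.
    rewrite (negbTE hi) in h4; move/eqP: hne; apply; apply: injB.
    by rewrite [LHS]surjective_pairing -h2 -h4 -surjective_pairing.
  - by rewrite /altA; case: ifP; rewrite inE.
  - by rewrite /altB; case: ifP; rewrite inE.
apply/forallP => S; apply/implyP => hS.
have -> : key rK rK1 S mu = key rK rK1 S (phi m').
  rewrite /key /mu /=; congr (_, _, _).
    by case: (eqVneq i rK) => [<-|//]; rewrite hS.
  by case: (eqVneq i rK1) => [<-|//]; rewrite hS.
by apply/eqP; apply: (hout i) => //; rewrite /m' hdec.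
Qed.

Lemma eventually_rate_gap_if (P : Prop) (x c l D : R) :
  (P -> 0 < x /\ x <= c) -> 0 < l < 1 -> exists n0 : nat, forall n, (n0 <= n)%N ->
  P -> D * Rpower 2 (INR n * (l * x)) <= Rpower 2 (INR n * c).
Proof.
move=> h hl; case: (excluded_middle_informative P) => [hP|hP]; last by exists 0%N.
have [hx hxc] := h hP; have [n0 hn0] := eventually_rate_gap D hx hxc hl.
by exists n0 => n /hn0.
Qed.

Lemma ceil_le_double (r : R) (M : nat) : 0 <= r ->
  INR M < Rpower 2 r + 1 -> INR M <= 2 * Rpower 2 r.
Proof.
move=> hr hM; have := Rpower2_le hr; rewrite Rpower_O; lra.
Qed.

Lemma ceil_eq1 (r : R) (M : nat) : r = 0 ->
  Rpower 2 r <= INR M < Rpower 2 r + 1 -> M = 1%N.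
Proof.
move=> ->; rewrite Rpower_O; last lra.
move=> [h1 h2]; apply/eqP; rewrite eqn_leq -ltnS; apply/andP; split.
  by apply: ltn_INR; rewrite S_INR /=; lra.
exact: leq_INR.
Qed.

Lemma leq_of_rates (Z M P : nat) (D y z : R) : INR M <= D * y ->
  INR Z * D * y <= z -> z = INR P -> (Z * M <= P)%N.
Proof.
move=> hM hz ez; apply: leq_INR; rewrite INR_muln -ez.
apply: Rle_trans hz; rewrite Rmult_assoc; apply: Rmult_le_compat_l => //.
exact: pos_INR.
Qed.

(** [al], [be] are common rates and [rhoA], [rhoB] private ones; the factor [l] leaves exponential
    room for rounding and for [Z]. A part of rate zero has a single value and admits no wrong one,
    so the last three bounds concern positive rates only. *)
Lemma achievable_split (al be rhoA rhoB l : R) :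
  0 <= al -> 0 <= be -> 0 <= rhoA -> 0 <= rhoB -> 0 < l < 1 ->
  let rA i := if i == rK then 0 else rhoA in
  let rB i := if i == rK1 then 0 else rhoB in
  (forall i, al + be + rA i + rB i <= capW N (Wset i)) ->
  (forall i, 0 < rA i -> 0 < rB i ->
     rA i + rB i <= capW N [set S in Wset i | ~~ ((rK \in S) && (rK1 \in S))]) ->
  (forall i, 0 < rA i -> rA i <= capW N [set S in Wset i | rK \notin S]) ->
  (forall i, 0 < rB i -> rB i <= capW N [set S in Wset i | rK1 \notin S]) ->
  achievable N (cmpl [set rK]) (cmpl [set rK1]) (l * (al + rhoA)) (l * (be + rhoB)).
Proof.
move=> hal hbe hA hB hl rA rB h1 h2 h3 h4.
split; first by apply: Rmult_le_pos; lra.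
split; first by apply: Rmult_le_pos; lra.
move=> eps heps.
(* This choice makes 4K/Z smaller than [eps]. *)
have [Z hZ] := INR_archimed (INR (4 * K) / eps).
have rA0 i : 0 <= rA i by rewrite /rA; case: ifP; lra.
have rB0 i : 0 <= rB i by rewrite /rB; case: ifP; lra.
have hpos i : 0 < al + be -> 0 < al + be + rA i + rB i.
  by move=> h; have := rA0 i; have := rB0 i; lra.
(* Rounding up at most doubles a size. The conditions involve four, two, one and one sizes, whence
   the constants 16, 4, 2 and 2. *)
have [n1 hn1] := eventually_forall_fin (fun i => eventually_rate_gap_if (INR Z * 16)
  (fun p : 0 < al + be => conj (hpos i p) (h1 i)) hl).
have [n2 hn2] := eventually_forall_fin (fun i => eventually_rate_gap_if (INR Z * 4)
  (fun p : 0 < rA i /\ 0 < rB i =>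
     conj (Rplus_lt_0_compat _ _ (proj1 p) (proj2 p)) (h2 i (proj1 p) (proj2 p))) hl).
have [n3 hn3] := eventually_forall_fin (fun i => eventually_rate_gap_if (INR Z * 2)
  (fun p : 0 < rA i => conj p (h3 i p)) hl).
have [n4 hn4] := eventually_forall_fin (fun i => eventually_rate_gap_if (INR Z * 2)
  (fun p : 0 < rB i => conj p (h4 i p)) hl).
exists (maxn (maxn n1 n2) (maxn n3 n4)) => n.
rewrite !geq_max => /andP [/andP [/hn1 {}hn1 /hn2 {}hn2] /andP [/hn3 {}hn3 /hn4 {}hn4]].
have hsub r : 0 <= r -> 0 <= INR n * (l * r).
  by move=> hr; apply: Rmult_le_pos; [exact: pos_INR | apply: Rmult_le_pos; lra].
have hceil r := exists_ceil (Rpower2_gt0 (INR n * (l * r))).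
have [MA hMA] := hceil (al + rhoA); have [MB hMB] := hceil (be + rhoB).
have [m1 hm1] := hceil al; have [m2 hm2] := hceil be.
have [mA hmA] := hceil rhoA; have [mB hmB] := hceil rhoB.
exists MA, MB; do 2!split=> //.
have ge1 r M : Rpower 2 (INR n * (l * r)) <= INR M -> (0 < M)%N.
  by move=> hr; apply: ltn_INR; have := Rpower2_gt0 (INR n * (l * r)) => /=; lra.
(* [M] exceeds the exact power by less than one, while the integer [m * m'] is at least that
   power. *)
have covers r s M m m' : Rpower 2 (INR n * (l * r)) <= INR m ->
    Rpower 2 (INR n * (l * s)) <= INR m' ->
    INR M < Rpower 2 (INR n * (l * (r + s))) + 1 -> (M <= #|{: 'I_m * 'I_m'}|)%N.
  move=> hm hm' hM; rewrite card_prod !card_ord -ltnS; apply: ltn_INR.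
  rewrite S_INR INR_muln; apply: Rlt_le_trans hM _.
  rewrite !Rmult_plus_distr_l Rpower_plus; apply: Rplus_le_compat_r.
  by apply: Rmult_le_compat => //; apply: Rlt_le; apply: Rpower2_gt0.
have [fA injA] := exists_inj_ord (covers _ _ _ _ _ (proj1 hm1) (proj1 hmA) (proj2 hMA)).
have [fB injB] := exists_inj_ord (covers _ _ _ _ _ (proj1 hm2) (proj1 hmB) (proj2 hMB)).
pose E r := Rpower 2 (INR n * (l * r)).
have ED r s : E (r + s) = E r * E s by rewrite /E !Rmult_plus_distr_l Rpower_plus.
have dbl r M : 0 <= r -> E r <= INR M < E r + 1 -> INR M <= 2 * E r.
  by move=> /hsub hr [_ hM]; apply: ceil_le_double hM.
have one r M : ~ 0 < r -> 0 <= r -> E r <= INR M < E r + 1 -> M = 1%N.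
  by move=> hn hr; apply: ceil_eq1; (have -> : r = 0 by lra); rewrite !Rmult_0_r.
have hnA i : E (rA i) <= INR (nA rK 'I_mA i) < E (rA i) + 1.
  rewrite /rA /nA card_ord; case: ifP => // _.
  by rewrite /E !Rmult_0_r Rpower_O /=; lra.
have hnB i : E (rB i) <= INR (nB rK1 'I_mB i) < E (rB i) + 1.
  rewrite /rB /nB card_ord; case: ifP => // _.
  by rewrite /E !Rmult_0_r Rpower_O /=; lra.
have subn1_le (M : nat) : INR (M - 1)%N <= INR M by apply: INR_leq; apply: leq_subr.
have [||||||] := exists_code (n := n) (Z := Z) _ _ injA injB.
- exact: ge1 (proj1 hMA).
- exact: ge1 (proj1 hMB).
- move=> i; case: (Rlt_dec 0 (al + be)) => hab; last first.
    have al0 : ~ 0 < al by lra.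
    have be0 : ~ 0 < be by lra.
    rewrite card_prod !card_ord (one _ _ al0 hal hm1) (one _ _ be0 hbe hm2).
    by rewrite !mul0n muln0.
  apply: leq_of_rates (hn1 i hab) _; last by rewrite -prod_block_size // set0_Wset.
  rewrite -/(E _) !INR_muln.
  have hX : INR (#|{: 'I_m1 * 'I_m2}| - 1)%N <= 4 * (E al * E be).
    apply: Rle_trans (subn1_le _) _; rewrite card_prod !card_ord INR_muln.
    have -> : 4 * (E al * E be) = (2 * E al) * (2 * E be) by ring.
    by apply: Rmult_le_compat; try exact: pos_INR; apply: dbl.
  have -> : 16 * E (al + be + rA i + rB i)
          = (4 * (E al * E be)) * (2 * E (rA i)) * (2 * E (rB i)) by rewrite !ED; ring.
  have p1 := pos_INR (#|{: 'I_m1 * 'I_m2}| - 1).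
  have p2 := pos_INR (nA rK 'I_mA i); have p3 := pos_INR (nB rK1 'I_mB i).
  apply: Rmult_le_compat; [exact: Rmult_le_pos| exact: p3 | | exact: dbl].
  by apply: Rmult_le_compat => //; apply: dbl.
- move=> i; case: (Rlt_dec 0 (rA i)) => hra; last first.
    by rewrite (one _ _ hra (rA0 i) (hnA i)) subnn mul0n muln0.
  case: (Rlt_dec 0 (rB i)) => hrb; last first.
    by rewrite (one _ _ hrb (rB0 i) (hnB i)) subnn !muln0.
  apply: leq_of_rates (hn2 i (conj hra hrb)) _; last first.
    by rewrite -prod_block_size // in_set negb_and set0_Wset.
  rewrite -/(E _) INR_muln ED.
  have -> : 4 * (E (rA i) * E (rB i)) = (2 * E (rA i)) * (2 * E (rB i)) by ring.
  by apply: Rmult_le_compat; try exact: pos_INR; apply: Rle_trans (subn1_le _) _; apply: dbl.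
- move=> i; case: (Rlt_dec 0 (rA i)) => hra; last first.
    by rewrite (one _ _ hra (rA0 i) (hnA i)) subnn muln0.
  apply: leq_of_rates (hn3 i hra) _; last first.
    by rewrite -prod_block_size // in_set negb_and set0_Wset.
  by apply: Rle_trans (subn1_le _) _; apply: dbl.
- move=> i; case: (Rlt_dec 0 (rB i)) => hrb; last first.
    by rewrite (one _ _ hrb (rB0 i) (hnB i)) subnn muln0.
  apply: leq_of_rates (hn4 i hrb) _; last first.
    by rewrite -prod_block_size // in_set negb_and set0_Wset.
  by apply: Rle_trans (subn1_le _) _; apply: dbl.
move=> enc [decA [decB hE]]; exists enc, decA, decB.
rewrite /Perr.
set err := #|_| in hE *.
have := INR_leq hE; rewrite mulnA INR_muln (INR_muln (4 * K)) => {}hE.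
have hM : 0 < INR (MA * MB)%N.
  by apply/lt_0_INR/ltP; rewrite muln_gt0 (ge1 _ _ (proj1 hMA)) (ge1 _ _ (proj1 hMB)).
have hZ0 : 0 < INR Z.
  apply: Rle_lt_trans hZ; apply: Rmult_le_pos; first exact: pos_INR.
  by apply: Rlt_le; apply: Rinv_0_lt_compat.
have hK : INR (4 * K) <= eps * INR Z.
  have -> : INR (4 * K) = eps * (INR (4 * K) / eps) by field; lra.
  by apply: Rmult_le_compat_l; lra.
apply: (@Rmult_le_reg_r (INR (MA * MB)%N)) => //.
rewrite /Rdiv Rmult_assoc Rinv_l ?Rmult_1_r; last lra.
apply: (@Rmult_le_reg_l (INR Z)) => //; apply: Rle_trans hE _.
have -> : INR Z * (eps * INR (MA * MB)%N) = (eps * INR Z) * INR (MA * MB)%N by ring.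
by apply: Rmult_le_compat_r; lra.
Qed.

End Achievability.

(** * The capacity region *)

Section Region.

Variables (K : nat) (N : {set 'I_K} -> nat).
Hypothesis hN : forall S : {set 'I_K}, S != set0 -> (0 < N S)%N.
Implicit Types (i j : 'I_K) (W : {set {set 'I_K}}).

Lemma capW_sep W (p : pred {set 'I_K}) : set0 \notin W ->
  capW N W = capW N [set S in W | p S] + capW N [set S in W | ~~ p S].
Proof.
move=> h0; rewrite -capW_setU ?inE ?(negbTE h0) //.
  by congr capW; apply/setP => S; rewrite !inE -andb_orr orbN andbT.
rewrite -setI_eq0; apply/eqP/setP => S; rewrite !inE.
by case: (S \in W); case: (p S).
Qed.

Lemma set0_sep W (p : pred {set 'I_K}) : set0 \notin W -> set0 \notin [set S in W | p S].
Proof. by move=> h0; rewrite inE (negbTE h0). Qed.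

Lemma subset_cmpl1 (S : {set 'I_K}) i : (S \subset cmpl [set i]) = (i \notin S).
Proof. by rewrite /cmpl -disjoints_subset disjoint_sym disjoints1. Qed.

Lemma down_cmpl1 W i : down W [set cmpl [set i]] = [set S in W | i \notin S].
Proof.
apply/setP => S; rewrite !inE; congr andb; apply/existsP/idP.
  by move=> [T]; rewrite inE => /andP [/eqP ->]; rewrite subset_cmpl1.
by move=> h; exists (cmpl [set i]); rewrite inE eqxx subset_cmpl1.
Qed.

Lemma down_cmpl2 W i j : down W [set cmpl [set i]; cmpl [set j]]
  = [set S in W | ~~ ((j \in S) && (i \in S))].
Proof.
apply/setP => S; rewrite !inE negb_and; congr andb; apply/existsP/idP.
  by move=> [T]; rewrite !inE => /andP [/orP [] /eqP ->]; rewrite subset_cmpl1 => ->; rewrite ?orbT.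
case/orP => h; [exists (cmpl [set j]) | exists (cmpl [set i])];
  by rewrite !inE eqxx ?orbT subset_cmpl1.
Qed.

(** Puts the bound for cooperating receivers in the form of the constraint involving both [rK1] and
    [rK]. *)
Lemma capW_WsetU i j : capW N (Wset i :|: Wset j)
  = capW N [set S in Wset i | j \notin S] + capW N (Wset j).
Proof.
rewrite -capW_setU ?set0_sep ?set0_Wset //.
  congr capW; apply/setP => S; rewrite 2!in_setU !in_set -!in_Wset !in_set.
  by case: (S != set0); case: (i \in S); case: (j \in S).
rewrite -setI_eq0; apply/eqP/setP => S; rewrite !inE.
by case: (j \in S); rewrite ?andbF.
Qed.

Lemma capW_Wset_sep_le i j : capW N [set S in Wset i | j \in S] <= capW N (Wset j).
Proof.
apply: capW_le => //; first exact: set0_Wset.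
by apply/subsetP => S; rewrite !inE => /andP [/andP [-> _] ->].
Qed.

Lemma capW_Wset_split i j : capW N (Wset i)
  = capW N [set S in Wset i | j \in S] + capW N [set S in Wset i | j \notin S].
Proof. exact: (capW_sep (fun S => j \in S) (set0_Wset i)). Qed.

(** The links of [k] containing both [i] and [j] are among those shared by [i] and [j]. With
    [capW_Wset_split] this yields the last constraint from the two before it. *)
Lemma capW_Wset_both i j k :
  capW N (Wset k) <= capW N [set S in Wset k | ~~ ((i \in S) && (j \in S))]
                     + capW N [set S in Wset j | i \in S].
Proof.
rewrite (capW_sep (fun S => (i \in S) && (j \in S)) (set0_Wset k)) Rplus_comm.
apply: Rplus_le_compat_l; apply: capW_le => //; first by rewrite set0_sep ?set0_Wset.
by apply/subsetP => S; rewrite !inE => /andP [/andP [-> _] /andP [-> ->]].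
Qed.

Lemma capW_Wset_both_sym i j :
  capW N [set S in Wset i | j \in S] = capW N [set S in Wset j | i \in S].
Proof. by congr capW; apply/setP => S; rewrite !inE -!andbA; congr andb; rewrite andbC. Qed.

End Region.

(** The witness is the minimum; the disjunction records which bound is tight. *)
Lemma exists_split (r c : R) : 0 <= r -> 0 <= c -> exists a, 0 <= a <= r /\ a <= c /\
  (a = r \/ a = c).
Proof.
move=> hr hc; case: (Rle_lt_dec r c) => h; first by exists r; split; [lra|tauto].
by exists c; split; [lra|split; [lra|tauto]].
Qed.

(* Receiver r of the paper is the ordinal r-1; rK = receiver K, rK1 = receiver K-1.
   RA = R_{bar K} (message required by [1:K-1]),
   RB = R_{bar (K-1)} (message required by [1:K] \ {K-1}). *)
Theorem theorem4 (K : nat) (hK : (3 <= K)%N) (rK rK1 : 'I_K)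
  (hrK : nat_of_ord rK = K.-1) (hrK1 : nat_of_ord rK1 = K.-2)
  (N : {set 'I_K} -> nat) (hN : forall S : {set 'I_K}, S != set0 -> (0 < N S)%N)
  (RA RB : R) :
  in_capacity_region N (cmpl [set rK]) (cmpl [set rK1]) RA RB <->
  ((0 <= RA) /\ (0 <= RB) /\
   (RB <= capW N (Wset rK)) /\
   (RA <= capW N (Wset rK1)) /\
   (forall j : 'I_K, (nat_of_ord j < K.-2)%N ->
      (RB + RA <= capW N (Wset j))) /\
   (RB + RA <= capW N (down (Wset rK1) [set cmpl [set rK]]) + capW N (Wset rK)) /\
   (forall j : 'I_K, (nat_of_ord j < K.-2)%N ->
      (2 * RB + 2 * RA <=
         capW N (down (Wset j) [set cmpl [set rK1]; cmpl [set rK]])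
         + capW N (Wset rK) + capW N (Wset rK1)))).
Proof.
have hne : rK != rK1 by apply/eqP => /(congr1 (@nat_of_ord K)); lia.
have hcommon (j : 'I_K) : (j < K.-2)%N = (j != rK) && (j != rK1).
  rewrite -!(inj_eq val_inj) /= hrK hrK1; have := ltn_ord j; lia.
rewrite down_cmpl1.
have s1 := capW_Wset_split hN rK1 rK; have s2 := capW_Wset_split hN rK rK1.
rewrite (capW_Wset_both_sym N rK rK1) in s2.
have both j := capW_Wset_both hN rK rK1 j.
split.
  move=> hreg.
  (* The region is a closure, so each bound is proved at nearby achievable pairs and passed to the
     limit. *)
  have close e : 0 < e -> exists a b, achievable N (cmpl [set rK]) (cmpl [set rK1]) a b
      /\ (RA - e < a < RA + e) /\ (RB - e < b < RB + e).
    move=> /hreg [a [b [hab [/Rabs_def2 ? /Rabs_def2 ?]]]].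
    by exists a, b; split=> //; lra.
  have inA j : j != rK -> j \in cmpl [set rK] by rewrite !inE.
  have inB j : j != rK1 -> j \in cmpl [set rK1] by rewrite !inE.
  have hneA : rK1 != rK by rewrite eq_sym.
  have hsum i j : i \in cmpl [set rK] -> j \in cmpl [set rK1] ->
      RB + RA <= capW N (Wset i :|: Wset j).
    move=> hi hj; apply: le_epsilon => e he.
    have [|a [b [/(achievable_le hN) [_ _ /(_ i j hi hj)] h]]] := close (e / 2); lra.
  have hj (j : 'I_K) : (j < K.-2)%N -> RB + RA <= capW N (Wset j).
    rewrite hcommon => /andP [h1 h2].
    by have := hsum j j (inA _ h1) (inB _ h2); rewrite setUid.
  have hKK : RB + RA <= capW N [set S in Wset rK1 | rK \notin S] + capW N (Wset rK).
    by rewrite -capW_WsetU //; apply: hsum; [apply: inA | apply: inB].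
  do 6?split=> //.
  - apply: le_epsilon => e he; have [|a [b [[h1 [h2 _]] h]]] := close e; lra.
  - apply: le_epsilon => e he; have [|a [b [[h1 [h2 _]] h]]] := close e; lra.
  - apply: le_epsilon => e he.
    have [|a [b [/(achievable_le hN) [_ /(_ rK (inB _ hne)) ? _] h]]] := close e; lra.
  - apply: le_epsilon => e he.
    have [|a [b [/(achievable_le hN) [/(_ rK1 (inA _ hneA)) ? _ _] h]]] := close e; lra.
  (* the last constraint is the sum of the two preceding ones *)
  - by move=> j /hj; have := both j; rewrite down_cmpl2; lra.
move=> [hA [hB [hBK [hAK1 [hj [hKK hj2]]]]]] eps heps.
(* Scaling by [l] moves each rate by less than [eps]; the added 1 keeps [l] positive when both rates
   vanish. *)
pose l := 1 - eps / (eps + RA + RB + 1).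
have hden : 0 < eps + RA + RB + 1 by lra.
have hd : 0 < eps / (eps + RA + RB + 1) by apply: Rdiv_lt_0_compat.
have el : (1 - l) * (eps + RA + RB + 1) = eps by rewrite /l; field; lra.
have hl0 : 0 < 1 - l by rewrite /l; lra.
have hl : 0 < l < 1 by split; nra.
(* Receiver [rK] decodes the second message and the common part of the first, so [al + RB] must fit
   its capacity; [be] is the mirror image at [rK1]. *)
have [al [hal [halK alE]]] : exists a, 0 <= a <= RA /\ a <= capW N (Wset rK) - RB /\
    (a = RA \/ a = capW N (Wset rK) - RB) by apply: exists_split; lra.
have [be [hbe [hbeK beE]]] : exists a, 0 <= a <= RB /\ a <= capW N (Wset rK1) - RA /\
    (a = RB \/ a = capW N (Wset rK1) - RA) by apply: exists_split; lra.
exists (l * (al + (RA - al))), (l * (be + (RB - be))); split; last first.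
  have -> : al + (RA - al) = RA by ring.
  have -> : be + (RB - be) = RB by ring.
  by split; apply: Rabs_def1; nra.
apply: achievable_split => //; try lra.
- move=> i; case: (eqVneq i rK) => [->|hiK].
    by rewrite (negbTE hne); lra.
  case: (eqVneq i rK1) => [->|hiK1]; first lra.
  by have := hj i; rewrite hcommon hiK hiK1 => /(_ isT); lra.
(* If both private rates are positive, both minima are capacity-limited, and the private rates add
   up to [2 * RB + 2 * RA] minus the two capacities: exactly the last constraint. *)
- move=> i; case: (eqVneq i rK) => [_|hiK]; first lra.
  case: (eqVneq i rK1) => [_|hiK1]; first lra.
  have := hj2 i; rewrite hcommon hiK hiK1 down_cmpl2 => /(_ isT); lra.
(* A positive private rate equals [RB + RA - capW N (Wset rK)]. At [rK1] the cooperative bound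
   applies; elsewhere the links containing [rK] cost at most the capacity of [rK]. *)
- move=> i; case: (eqVneq i rK) => [_|hiK]; first lra.
  case: (eqVneq i rK1) => [->|hiK1]; first lra.
  have := hj i; rewrite hcommon hiK hiK1 => /(_ isT).
  have := capW_Wset_split hN i rK; have := capW_Wset_sep_le hN i rK; lra.
(* Same argument mirrored: [s1] and [s2] exchange [rK] and [rK1] in the cooperative bound. *)
- move=> i; case: (eqVneq i rK1) => [_|hiK1]; first lra.
  case: (eqVneq i rK) => [->|hiK]; first lra.
  have := hj i; rewrite hcommon hiK hiK1 => /(_ isT).
  have := capW_Wset_split hN i rK1; have := capW_Wset_sep_le hN i rK1; lra.
Qed.
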